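(* Let $f(\mathbf{x})=\frac12\mathbf{x}^\top A\mathbf{x}+b^\top\mathbf{x}+c$ for $\mathbf{x}\in\mathbb{R}^d$, where $A=(a_{ij})\in\mathbb{R}^{d\times d}$ is symmetric positive definite, $b\in\mathbb{R}^d$ and $c\in\mathbb{R}$. Let $\alpha_k\in(0,1)$, $\beta_k\in\mathbb{R}$, and let $\mathbf{x}^{(k)}=(x_j^k)$, $\mathbf{c}_k=(c_j^k)\in\mathbb{R}^d$ with $x_j^k\neq c_j^k$ for all $j$. Then the direction $$\vec{\mathbf{d}}_k = \mathrm{diag}\big({}_{c_j^k}^{C}D^{\alpha_k}_{x} I(x^k_j)\big)^{-1}\Big[ {}_{\mathbf{c}_k}^{C}\nabla^{\alpha_k}_{\mathbf{x}} f(\mathbf{x}^{(k)})+\beta_k\, \mathrm{diag}\big(|x^k_j-c^k_j|\big)\; {}_{\mathbf{c}_k}^{C}\nabla^{1+\alpha_k}_{\mathbf{x}} f(\mathbf{x}^{(k)})\Big]$$ is explicitly given by $$\vec{\mathbf{d}}_k = A\mathbf{x}^{(k)}+b+\gamma_{\alpha_k,\beta_k}\,\mathrm{diag}(\tilde R)\,(\mathbf{x}^{(k)}-\mathbf{c}_k),$$ where $\gamma_{\alpha,\beta}=\beta-\frac{1-\alpha}{2-\alpha}$ and $\tilde R=(a_{11},\dots,a_{dd})^\top$.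
   Context: Caputo fractional derivatives. Let $\nu\in(n-1,n)$ with $n\in\mathbb{N}$, and let $c\in\mathbb{R}$. For $x>c$, ${}_{c}^{C}D_x^{\nu} g(x)=\frac{1}{\Gamma(n-\nu)}\int_c^x \frac{g^{(n)}(t)}{(x-t)^{\nu-n+1}}\,dt$ (left Caputo derivative). For $x<c$, the same symbol is understood as the right Caputo derivative ${}_{c}^{C}D_x^{\nu} g(x)=\frac{(-1)^n}{\Gamma(n-\nu)}\int_x^c \frac{g^{(n)}(t)}{(t-x)^{\nu-n+1}}\,dt$. $\Gamma$ is the Gamma function and $I(x)=x$ is the identity map on $\mathbb{R}$. Caputo fractional gradient. For $\mathbf{x}=(x_j)\in\mathbb{R}^d$ put $f_{j,\mathbf{x}}(y)=f(\mathbf{x}+(y-x_j)e_j)$, with $e_j$ the $j$-th standard basis vector. For $\mathbf{c}=(c_j)\in\mathbb{R}^d$, ${}_{\mathbf{c}}^{C}\nabla_{\mathbf{x}}^{\nu} f(\mathbf{x})\in\mathbb{R}^d$ is the vector whose $j$-th component is ${}_{c_j}^{C}D_x^{\nu} f_{j,\mathbf{x}}$ evaluated at $x_j$. For a vector $v=(v_j)$, $\mathrm{diag}(v)$ or $\mathrm{diag}(v_j)$ is the $d\times d$ diagonal matrix with $(j,j)$ entry $v_j$. *)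

(* Defs.v *)
From mathcomp Require Import all_boot all_order all_algebra.
From mathcomp Require Import all_classical all_reals all_analysis.
Import Order.TTheory GRing.Theory Num.Theory.
Import numFieldNormedType.Exports.

Set Implicit Arguments.
Unset Strict Implicit.
Unset Printing Implicit Defensive.

Local Open Scope classical_set_scope.
Local Open Scope ring_scope.

(* Euler's integral, intended for s > 0; the library has no Gamma function. *)
Definition Gamma (R : realType) (s : R) : R :=
  \int[@lebesgue_measure R]_(t in `]0, +oo[) (t `^ (s - 1) * expR (- t)).

(* For a non-integer nu > 0, the n with n - 1 < nu < n. *)
Definition caputo_order (R : realType) (nu : R) : nat := `|Num.ceil nu|%N.

Lemma caputo_orderE (R : realType) (nu : R) (n : nat) :
  n%:R - 1 < nu < n%:R -> caputo_order nu = n.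
Proof.
move=> /andP[h1 h2]; rewrite /caputo_order (@ceil_def _ _ n%:Z) ?absz_nat //.
by rewrite intrB -pmulrn h1 /= ltW.
Qed.

(* The integrands are singular at t = x, whence the open intervals. *)
Definition caputo_left (R : realType) (c nu : R) (g : R -> R) (x : R) : R :=
  let n := caputo_order nu in
  (Gamma (n%:R - nu))^-1 *
  \int[@lebesgue_measure R]_(t in `]c, x[)
     (derive1n n g t / (x - t) `^ (nu - n%:R + 1)).

Definition caputo_right (R : realType) (c nu : R) (g : R -> R) (x : R) : R :=
  let n := caputo_order nu in
  (-1) ^+ n / Gamma (n%:R - nu) *
  \int[@lebesgue_measure R]_(t in `]x, c[)
     (derive1n n g t / (t - x) `^ (nu - n%:R + 1)).

(* Only meaningful for x != c. *)
Definition caputo (R : realType) (c nu : R) (g : R -> R) (x : R) : R :=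
  if c < x then caputo_left c nu g x else caputo_right c nu g x.

Definition coord_fun (R : realType) (d : nat) (f : 'cV[R]_d -> R)
    (x : 'cV[R]_d) (j : 'I_d) (y : R) : R :=
  f (x + (y - x j 0) *: delta_mx j 0).

Definition caputo_gradient (R : realType) (d : nat) (c : 'cV[R]_d) (nu : R)
    (f : 'cV[R]_d -> R) (x : 'cV[R]_d) : 'cV[R]_d :=
  \col_j caputo (c j 0) nu (coord_fun f x j) (x j 0).

Definition caputo_direction (R : realType) (d : nat) (f : 'cV[R]_d -> R)
    (alpha beta : R) (x c : 'cV[R]_d) : 'cV[R]_d :=
  invmx (diag_mx (\row_j caputo (c j 0) alpha idfun (x j 0))) *m
  (caputo_gradient c alpha f x +
   beta *: (diag_mx (\row_j `|x j 0 - c j 0|) *m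
            caputo_gradient c (1 + alpha) f x)).

Definition gamma_coef (R : realType) (alpha beta : R) : R :=
  beta - (1 - alpha) / (2 - alpha).

Definition posdefmx (R : realType) (d : nat) (A : 'M[R]_d) : Prop :=
  forall v : 'cV[R]_d, v != 0 -> 0 < (v^T *m A *m v) 0 0.

Definition quadratic (R : realType) (d : nat) (A : 'M[R]_d) (b : 'cV[R]_d)
    (c : R) (x : 'cV[R]_d) : R :=
  2^-1 * (x^T *m A *m x) 0 0 + (b^T *m x) 0 0 + c.

(* Main.v *)
(** Along the [j]-th coordinate a quadratic function is a polynomial of degree
    two in [y - x_j], with derivative [(A x + b)_j + a_jj (y - x_j)] and second
    derivative [a_jj].  With [p = 1 - alpha], everything therefore reduces to
    the moments [\int |t - x|^(q - 1) dt = |x - c|^q / q] over the interval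
    between [c] and [x], for [q = p] and [q = p + 1].  The common factor
    [sg (x - c) |x - c|^p / Gamma p] cancels against the inverted diagonal
    matrix; this needs Euler's integral to be positive and finite, an infinite
    one being assigned the value [0] by [Rintegral]. *)
Require Import Defs.
From mathcomp Require Import all_boot all_order all_algebra.
From mathcomp Require Import all_classical all_reals all_analysis.
From mathcomp Require Import measurable_realfun.
From mathcomp Require Import ring lra.
Import Order.TTheory GRing.Theory Num.Theory.
Import numFieldNormedType.Exports.

Set Implicit Arguments.
Unset Strict Implicit.
Unset Printing Implicit Defensive.

Local Open Scope classical_set_scope.
Local Open Scope ring_scope.

(** * Integrals over open intervals as limits over compact ones *)

(* Unlike in [continuous_FTC2], [f] may be unbounded near [a] and [b]. *)
Lemma ge0_continuous_FTC2_oo (R : realType) (f F : R -> R) (a b : R) :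
  a < b ->
  {in `]a, b[, continuous f} ->
  {in `]a, b[, forall t, 0 <= f t} ->
  derivable_oo_LRcontinuous F a b ->
  {in `]a, b[, F^`()%classic =1 f} ->
  (\int[@lebesgue_measure R]_(t in `]a, b[) (f t)%:E = (F b - F a)%:E)%E.
Proof.
move=> ab cf f0 [dF Fa Fb] dFf.
(* The cutoffs tend to 0; the factor 1/4 keeps each compact interval [A n] nondegenerate, even for
   [n = 0]. *)
pose w n := (b - a) / 4 * @harmonic R n.
have w_gt0 n : 0 < w n by rewrite mulr_gt0 ?harmonic_gt0// divr_gt0 ?subr_gt0.
have w_le n : w n <= (b - a) / 4.
  rewrite ler_piMr//=; first by rewrite divr_ge0// subr_ge0 ltW.
  by rewrite invf_le1 ?ler1n ?ltr0Sn.
have wD k : a + w k < b - w k by have := w_le k; lra.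
have cvg_w : w n @[n --> \oo] --> (0 : R).
  by rewrite -(mulr0 ((b - a) / 4)); apply: cvgMr; exact: cvg_harmonic.
pose A (k : nat) : set R := `[a + w k, b - w k]%classic.
have Asub n : A n `<=` `]a, b[.
  move=> t; rewrite /A /= !in_itv/= => /andP[h1 h2].
  by have ? := w_gt0 n; apply/andP; split; lra.
have inA n t : t \in `[a + w n, b - w n] -> t \in `]a, b[ := Asub n t.
have UA : \bigcup_n A n = `]a, b[%classic.
  apply/seteqP; split=> [t [n _]|t]; first exact: Asub.
  rewrite /= in_itv/= => /andP[ta tb].
  have m0 : 0 < Num.min (t - a) (b - t) by rewrite lt_min !subr_gt0 ta.
  have [N _ /(_ N (leqnn N))] := cvgr_le 0 cvg_w _ m0.
  rewrite /= le_min => /andP[h1 h2].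
  by exists N => //; rewrite /A /= in_itv/=; apply/andP; split; lra.
have mf : measurable_fun (`]a, b[ : set R) f.
  by apply: open_continuous_measurable_fun => // t; rewrite inE => /cf.
(* Monotone convergence along the exhaustion, using [0 <= f]. The ordinary fundamental theorem on
   each [A n] then identifies the limit. *)
have : (\int[@lebesgue_measure R]_(t in A n) (f t)%:E)%E @[n --> \oo] -->
    (\int[@lebesgue_measure R]_(t in \bigcup_n A n) (f t)%:E)%E.
  apply: ge0_nondecreasing_set_cvg_integral => //.
  - apply/nondecreasing_seqP => n; rewrite subsetEset.
    have h : w n.+1 <= w n.
      rewrite ler_pM2l ?divr_gt0 ?subr_gt0//=.
      by rewrite lef_pV2 ?ler_nat// posrE ltr0Sn.
    move=> t; rewrite /A /= !in_itv/= => /andP[h1 h2].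
    by apply/andP; split; lra.
  - by move=> n; exact: measurable_itv.
  - by move=> n; apply/measurable_EFinP; apply: measurable_funS mf.
  - by move=> n t /inA /f0; rewrite lee_fin.
rewrite UA => /(cvg_unique _); apply => //.
have -> : (fun n => \int[@lebesgue_measure R]_(t in A n) (f t)%:E)%E =
    (fun n => (F (b - w n) - F (a + w n))%:E).
  apply/funext => n; rewrite EFinB; apply: continuous_FTC2 => //.
  - apply: continuous_in_subspaceT => t; rewrite inE => tA.
    by apply: cf; exact: inA tA.
  - have dFc : {within `[a + w n, b - w n], continuous F}.
      by apply: derivable_within_continuous => t /inA /dF.
    have /(continuous_within_itvP _ (wD n))[_ ? ?] := dFc.
    split => // t tA; apply: dF; apply: (inA n).
    exact: subset_itv_oo_cc tA.
  - by move=> t tA; apply: dFf; apply: (inA n); exact: subset_itv_oo_cc tA.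
apply: cvg_EFin; first exact: nearW.
apply: cvgB.
- move/cvg_at_leftP : Fb; apply; split => [n|]; first by rewrite ltrBlDr ltrDl.
  by rewrite -[X in _ --> X]subr0; apply: cvgB => //; exact: cvg_cst.
- move/cvg_at_rightP : Fa; apply; split => [n|]; first by rewrite ltrDl.
  by rewrite -[X in _ --> X]addr0; apply: cvgD => //; exact: cvg_cst.
Qed.

(** * Moments of the distance to an endpoint *)

(** A signed antiderivative of [|u|^(q-1)] on both sides of 0, so that left and right Caputo
    derivatives share one computation. *)
Definition powR_primitive (R : realType) (q u : R) : R :=
  Num.sg u * `|u| `^ q / q.

Lemma is_derive_powR_primitive (R : realType) (q u : R) : q != 0 -> u != 0 ->
  is_derive u 1 (powR_primitive q) (`|u| `^ (q - 1)).
Proof.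
move=> q0; case: ltgtP => // u0 _.
- rewrite ltr0_norm//.
  apply: (@near_eq_is_derive _ R R ((- q^-1) \*: ((@powR R ^~ q) \o -%R))
    (@powR_primitive R q)).
    near=> v; have v0 : v < 0 by near: v; exact: lt_nbhsl.
    rewrite /powR_primitive ltr0_sg// ltr0_norm// mulN1r.
    by rewrite [LHS]mulNr mulrC mulNr.
  have dN : is_derive u 1 (-%R : R -> R) (-1) by exact: is_deriveNid.
  have Nu0 : 0 < - u by rewrite oppr_gt0.
  have := is_derive1_comp (is_derive1_powR q Nu0) dN.
  move=> /(is_deriveZ (- q^-1)) => h; apply: (is_derive_eq h).
  by rewrite /GRing.scale/=; field.
- rewrite gtr0_norm//.
  apply: (@near_eq_is_derive _ R R (q^-1 \*: (@powR R ^~ q))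
    (@powR_primitive R q)).
    near=> v; have v0 : 0 < v by near: v; exact: lt_nbhsr.
    by rewrite /powR_primitive gtr0_sg// gtr0_norm// mul1r [LHS]mulrC.
  have /(is_deriveZ q^-1) h := is_derive1_powR q u0.
  apply: (is_derive_eq h).
  by rewrite /GRing.scale/=; field.
Unshelve. all: by end_near. Qed.

Lemma continuous_powR_primitive (R : realType) (q : R) : 0 < q ->
  continuous (powR_primitive q).
Proof.
move=> q0 u; have [->|u0] := eqVneq u 0; last first.
  apply: differentiable_continuous; apply/derivable1_diffP.
  by have [] := is_derive_powR_primitive (lt0r_neq0 q0) u0.
have p0 : powR_primitive q 0 = 0 by rewrite /powR_primitive sgr0 !mul0r.
rewrite /continuous_at p0.
apply/cvgr0Pnorm_lt => e e0; have eq0 : 0 < e * q by rewrite mulr_gt0.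
near=> v.
have [->|v0] := eqVneq v 0; first by rewrite p0 normr0.
rewrite /powR_primitive !normrM normr_sg v0 mul1r.
rewrite (ger0_norm (powR_ge0 _ _)) gtr0_norm ?invr_gt0// ltr_pdivrMr//.
(* Writing [e * q] as a [q]-th power gives the radius [(e * q)^(1/q)]. *)
rewrite -[ltRHS](powRr1 (ltW eq0)) -(mulVf (lt0r_neq0 q0)) powRrM.
rewrite gt0_ltr_powR ?nnegrE ?powR_ge0//.
near: v; exact: (@nbhs0_lt R R _ (powR_gt0 _ eq0)).
Unshelve. all: by end_near. Qed.

(** For [t] strictly between [c] and [x], the difference [x - t] has the sign of [x - c]. This
    treats both orders of [c] and [x] at once. *)
Lemma in_itv_min_max (R : realType) (c x t : R) :
  t \in `]Num.min c x, Num.max c x[ ->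
  t != x /\ Num.sg (x - c) * (x - t) = `|t - x|.
Proof.
rewrite in_itv/=; case: (ltgtP c x) => [cx|xc|->]; last first.
- by move=> /andP[h1 h2]; have := lt_trans h1 h2; rewrite ltxx.
- move=> /andP[xt tc]; split; first by rewrite gt_eqF.
  by rewrite ltr0_sg ?subr_lt0// mulN1r opprB gtr0_norm ?subr_gt0.
- move=> /andP[ct tx]; split; first by rewrite lt_eqF.
  by rewrite gtr0_sg ?subr_gt0// mul1r ltr0_norm ?subr_lt0// opprB.
Qed.

Lemma measurable_powR_dist (R : realType) (p x : R) :
  measurable_fun [set: R] (fun t : R => `|t - x| `^ p).
Proof.
apply: (measurableT_comp (measurable_powR p)).
apply: measurableT_comp => //; exact: measurable_funB.
Qed.

Lemma integral_powR_dist (R : realType) (q c x : R) : 0 < q -> x != c ->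
  (\int[@lebesgue_measure R]_(t in `]Num.min c x, Num.max c x[)
     (`|t - x| `^ (q - 1))%:E = (`|x - c| `^ q / q)%:E)%E.
Proof.
move=> q0 xc.
have d1 (t : R) : is_derive t 1 (fun u : R => u - x) 1.
  by apply: is_derive_eq; rewrite subr0.
have dH t : t != x ->
    is_derive t 1 (powR_primitive q \o (fun u => u - x)) (`|t - x| `^ (q - 1)).
  move=> tx; rewrite -[X in is_derive _ _ _ X]mulr1.
  apply: is_derive1_comp; apply: is_derive_powR_primitive.
    exact: lt0r_neq0.
  by rewrite subr_eq0.
have cH : continuous (powR_primitive q \o (fun u => u - x)).
  move=> t; apply: continuous_comp; last exact: continuous_powR_primitive.
  by apply: differentiable_continuous; apply/derivable1_diffP; have [] := d1 t.
have mM : Num.min c x < Num.max c x by case: (ltgtP c x) xc.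
rewrite (@ge0_continuous_FTC2_oo _ _ (powR_primitive q \o (fun u => u - x)))//.
(* One endpoint is [x], where the primitive vanishes; only the value at [c] contributes. *)
- congr EFin; rewrite /powR_primitive/=.
  case: (ltgtP c x) xc => // [cx|xc] _.
    rewrite subrr sgr0 !mul0r ltr0_sg ?subr_lt0// distrC; ring.
  by rewrite subrr sgr0 !mul0r gtr0_sg ?subr_gt0// distrC; ring.
- move=> t /in_itv_min_max[tx _].
  apply: (@continuous_comp _ _ _ (fun u : R => `|u - x|)
    (fun u => u `^ (q - 1))).
    apply: (@continuous_comp _ _ _ (fun u : R => u - x));
      last exact: norm_continuous.
    by apply: differentiable_continuous; apply/derivable1_diffP; have [] := d1 t.
  apply: differentiable_continuous; apply/derivable1_diffP/derivable_powR.
  by rewrite in_itv/= andbT normr_gt0 subr_eq0.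
- split; first by move=> t /in_itv_min_max[/dH[]].
    exact/cvg_at_right_filter/cH.
  exact/cvg_at_left_filter/cH.
- by move=> t /in_itv_min_max[/dH dt _]; rewrite derive1E; exact: derive_val.
Qed.

Lemma integrable_powR_dist (R : realType) (q c x : R) : 0 < q -> x != c ->
  (@lebesgue_measure R).-integrable `]Num.min c x, Num.max c x[
    (fun t => (`|t - x| `^ (q - 1))%:E).
Proof.
move=> q0 xc; apply/integrableP; split.
  apply/measurable_EFinP; exact: measurable_funTS (measurable_powR_dist _ _).
under eq_integral do rewrite gee0_abs ?lee_fin ?powR_ge0//.
by rewrite integral_powR_dist// ltry.
Qed.

(** * Finiteness and positivity of Euler's integral *)

(** For [p <= 1], the factor [t^(p-1)] is at least 1 on []0, 1[] and at most 1 beyond. The first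
    bound gives positivity, the second integrability at infinity. *)
Lemma Gamma_gt0 (R : realType) (p : R) : 0 < p <= 1 -> 0 < Gamma p.
Proof.
move=> /andP[p0 p1]; rewrite /Gamma.
set D := `]0, +oo[%classic; set f := fun t : R => t `^ (p - 1) * expR (- t).
have mI : measurable (`]0, 1[%classic : set (measurableTypeR R)).
  exact: measurable_itv.
have mD : measurable (D : set (measurableTypeR R)).
  exact: measurable_itv.
have mu01 : @lebesgue_measure R `]0, 1[%classic = 1%E.
  by rewrite (@lebesgue_measure_itv R)/= lte_fin ltr01 sube0.
have fI : (@lebesgue_measure R).-integrable D (EFin \o f).
  (* The dominating function is [t^(p-1)] on []0, 1[] plus the exponential density of rate 1. *)
  pose g : R -> \bar R :=
    ((EFin \o ((fun t : R => `|t - 0| `^ (p - 1)) \_ `]0, 1[)%R) \+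
     (EFin \o @exponential_pdf R 1%R))%E.
  apply: (@le_integrable _ _ _ (@lebesgue_measure R) D mD (EFin \o f) g) => //.
  - apply/measurable_EFinP; apply: measurable_funTS; apply: measurable_funM.
      exact: measurable_powR.
    by apply: measurableT_comp => //; exact: measurable_funN.
  - move=> t; rewrite /D/= in_itv/= andbT => t0.
    rewrite lee_fin ger0_norm ?mulr_ge0 ?powR_ge0 ?expR_ge0//.
    apply: le_trans (ler_norm _); rewrite exponential_pdfE ?(ltW t0)// mul1r mulN1r.
    rewrite patchE subr0; case: ifPn => [_|].
      rewrite (gtr0_norm t0) ler_wpDr ?expR_ge0// ler_piMr ?powR_ge0//.
      by rewrite expR_le1 oppr_le0 (ltW t0).
    rewrite notin_setE/= in_itv/= t0/= => /negP; rewrite -leNgt => t1.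
    (* Outside []0, 1[] the restriction takes the default value [point], which is 0 in [R]. *)
    rewrite (_ : point = 0)// add0r ler_piMl ?expR_ge0//.
    by rewrite -[leRHS](powRr0 t) ler_powR//; lra.
  - apply: integrableD => //.
      apply: (@integrableS _ _ _ _ setT) => //.
      (* This is the moment with [q = p], [c = 1] and [x = 0]. *)
      have /(integrable_mkcond _ mI) : (@lebesgue_measure R).-integrable
          `]0, 1[ (fun t => (`|t - 0| `^ (p - 1))%:E).
        have := @integrable_powR_dist R p 1 0 p0.
        by rewrite min_r ?max_l// eq_sym; apply; exact: oner_neq0.
      by rewrite restrict_EFin.
    apply: (@integrableS _ _ _ _ setT) => //; exact: integrable_exponential_pdf.
(* On []0, 1[] the integrand is at least [e^(-1)], which bounds the integral below by [e^(-1)]. *)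
set h : R -> R := (cst (expR (- 1) : R)) \_ `]0, 1[.
have h_ge0 t : 0 <= h t.
  by rewrite /h patchE; case: ifP => // _; exact: expR_ge0.
have h_le_f t : D t -> h t <= f t.
  rewrite /D/= in_itv/= andbT => t0.
  rewrite /h patchE; case: ifPn => [|_]; last by rewrite mulr_ge0 ?powR_ge0 ?expR_ge0.
  rewrite inE/= in_itv/= => /andP[_ t1].
  rewrite -[leLHS]mul1r ler_pM ?expR_ge0 ?ler_expR ?lerN2 ?(ltW t1)//.
  by rewrite -[leLHS](powRr0 t) ger_powR ?t0 ?(ltW t1)//; lra.
apply: (@lt_le_trans _ _ (\int[@lebesgue_measure R]_(t in D) h t)).
  rewrite -Rintegral_mkcondl setIidl; last first.
    by move=> t; rewrite /D/= !in_itv/= andbT => /andP[].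
  by rewrite Rintegral_cst//= mu01 mulr1 expR_gt0.
apply: le_Rintegral => //.
apply: (@le_integrable _ _ _ (@lebesgue_measure R) D mD (EFin \o h) _ _ _ fI).
  apply/measurable_EFinP/measurable_funTS.
  by apply/(measurable_restrict _ mI) => //; exact: measurable_cst.
move=> t Dt; rewrite lee_fin (ger0_norm (h_ge0 t)).
exact: le_trans (h_le_f t Dt) (ler_norm _).
Qed.

(** * Caputo derivatives when the top derivative is affine *)

(** The sign of [x - c] raised to [n] is 1 on the left and [(-1)^n] on the right, which merges the
    two definitions. *)
Lemma caputoE (R : realType) (c nu : R) (g : R -> R) (x : R) : x != c ->
  let n := caputo_order nu in
  caputo c nu g x = Num.sg (x - c) ^+ n / Gamma (n%:R - nu) *
    \int[@lebesgue_measure R]_(t in `]Num.min c x, Num.max c x[)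
      (derive1n n g t / `|t - x| `^ (nu - n%:R + 1)).
Proof.
move=> xc n; rewrite /caputo.
have [cx|cx] := ltP c x.
- have -> : Num.sg (x - c) = 1 by rewrite gtr0_sg ?subr_gt0.
  rewrite expr1n mul1r /caputo_left -/n.
  congr (_ * _); apply: eq_Rintegral => t; rewrite inE/= in_itv/= => /andP[_ tx].
  by rewrite ltr0_norm ?subr_lt0// opprB.
- have {cx}xc' : x < c by rewrite lt_neqAle xc.
  have -> : Num.sg (x - c) = -1 by rewrite ltr0_sg ?subr_lt0.
  rewrite /caputo_right -/n.
  congr (_ * _); apply: eq_Rintegral => t; rewrite inE/= in_itv/= => /andP[xt _].
  by rewrite gtr0_norm ?subr_gt0.
Qed.

(** Since [t - x = - s |t - x|] on the interval, the integrand is a combination of the powers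
    [p - 1] and [p] of [|t - x|], whose integrals are the moments for [q = p] and [q = p + 1]. *)
Lemma caputo_affine (R : realType) (c nu : R) (g : R -> R) (x G a : R) (n : nat) :
  x != c -> n%:R - 1 < nu < n%:R ->
  derive1n n g = (fun t => G + a * (t - x)) ->
  let s := Num.sg (x - c) in let p := n%:R - nu in
  caputo c nu g x = s ^+ n / Gamma p * `|x - c| `^ p *
    (G / p - a * (x - c) / (p + 1)).
Proof.
move=> xc nun dg s p; rewrite caputoE// (caputo_orderE nun) dg.
have p0 : 0 < p by rewrite /p; lra.
rewrite -!mulrA; congr (_ * (_ * _)).
have -> : nu - n%:R + 1 = - (p - 1) by rewrite /p; ring.
have I1 := integrable_powR_dist p0 xc.
have p10 : 0 < p + 1 by rewrite addr_gt0.
have I2 := integrable_powR_dist p10 xc.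
rewrite addrK in I2.
have mJ : measurable (`]Num.min c x, Num.max c x[%classic : set (measurableTypeR R)).
  exact: measurable_itv.
have s2 : s * s = 1 by rewrite /s -expr2 sqr_sg subr_eq0 xc.
transitivity (\int[@lebesgue_measure R]_(t in `]Num.min c x, Num.max c x[)
   (G * `|t - x| `^ (p - 1) - a * s * `|t - x| `^ p)).
  apply: eq_Rintegral => t; rewrite inE/= => /in_itv_min_max[tx st].
  rewrite powRN invrK mulrDl -(mulr_powRB1 (normr_ge0 (t - x)) p0) -{4}st -/s.
  transitivity (G * `|t - x| `^ (p - 1) - a * (s * s) * (x - t) * `|t - x| `^ (p - 1)).
    by rewrite s2; ring.
  ring.
have EM r (h : R -> R) :
    EFin \o (fun t => r * h t) = (fun t => r%:E * (h t)%:E)%E.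
  by apply/funext => t /=; rewrite EFinM.
rewrite RintegralB//; last 2 first.
- rewrite EM; exact: (integrableZl mJ G I1).
- rewrite EM; exact: (integrableZl mJ (a * s) I2).
rewrite !RintegralZl//.
rewrite /Rintegral integral_powR_dist//.
have := integral_powR_dist p10 xc; rewrite addrK => -> /=.
(* One factor [|x - c|] is split off the second moment; with [s] it makes [x - c]. *)
rewrite -(mulr_powRB1 (normr_ge0 (x - c)) p10) addrK.
rewrite -[X in a * (X / _)]mulr_sg_norm -/s; ring.
Qed.

(** * The quadratic function along a coordinate line *)

Lemma derive1_quadratic_at (R : realType) (C G a x : R) :
  (fun y : R => C + G * (y - x) + 2^-1 * a * (y - x) ^+ 2)^`()%classic =
  (fun y => G + a * (y - x)).
Proof.
apply/funext => y; rewrite derive1E.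
apply: derive_val.
apply: is_derive_eq.
by rewrite /GRing.scale/=; field.
Qed.

Lemma derive1_affine_at (R : realType) (G a x : R) :
  (fun y : R => G + a * (y - x))^`()%classic = (fun=> a).
Proof.
apply/funext => y; rewrite derive1E.
apply: derive_val.
apply: is_derive_eq.
by rewrite /GRing.scale/=; field.
Qed.

(** The exact Taylor expansion at [x_j]: symmetry of [A] makes the two cross terms equal, which
    cancels the factor 1/2. *)
Lemma coord_fun_quadratic (R : realType) (d : nat) (A : 'M[R]_d) (b : 'cV[R]_d)
    (c : R) (x : 'cV[R]_d) (j : 'I_d) : A^T = A ->
  coord_fun (quadratic A b c) x j =
  (fun y => quadratic A b c x + (A *m x + b) j 0 * (y - x j 0) +
            2^-1 * A j j * (y - x j 0) ^+ 2).
Proof.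
move=> As; apply/funext => y; rewrite /coord_fun.
set h := y - x j 0; set e : 'cV[R]_d := delta_mx j 0.
have eM (B : 'cV[R]_d) : (e^T *m B) 0 0 = B j 0.
  by rewrite trmx_delta -rowE mxE.
(* A 1 by 1 matrix equals its transpose, so [x^T A e = e^T A^T x]. *)
have tr (M : 'M[R]_1) : M 0 0 = M^T 0 0 by rewrite mxE.
have xAe : (x^T *m A *m e) 0 0 = (A *m x) j 0.
  by rewrite tr !trmx_mul trmxK As eM.
have be : (b^T *m e) 0 0 = b j 0 by rewrite tr trmx_mul trmxK eM.
have xhe : (x + h *: e)^T = x^T + h *: e^T by rewrite linearD linearZ.
rewrite /quadratic xhe !mulmxDl !mulmxDr -!scalemxAl -!scalemxAr.
have mD (M N : 'M[R]_1) : (M + N) 0 0 = M 0 0 + N 0 0 by rewrite mxE.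
have mZ k (M : 'M[R]_1) : (k *: M) 0 0 = k * M 0 0 by rewrite mxE.
rewrite !mD !mZ xAe be -!(mulmxA e^T) !eM -colE !mxE.
by field.
Qed.

(** * Assembling the direction coordinate by coordinate *)

Theorem corollary3p1 (R : realType) (d : nat)
    (A : 'M[R]_d) (b : 'cV[R]_d) (c : R)
    (A_sym : A^T = A) (A_posdef : posdefmx A)
    (alpha_k beta_k : R) (x_k c_k : 'cV[R]_d)
    (alpha_k01 : 0 < alpha_k < 1)
    (x_neq_c : forall j : 'I_d, x_k j 0 != c_k j 0) :
  caputo_direction (quadratic A b c) alpha_k beta_k x_k c_k =
  A *m x_k + b +
  gamma_coef alpha_k beta_k *: (diag_mx (\row_j A j j) *m (x_k - c_k)).
Proof.
have /andP[a0 a1] := alpha_k01.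
have p0 : 0 < 1 - alpha_k by rewrite subr_gt0.
have n1 : 1%:R - 1 < alpha_k < 1%:R by rewrite subrr a0.
have n2 : 2%:R - 1 < 1 + alpha_k < 2%:R by apply/andP; split; lra.
have Gneq0 : Gamma (1 - alpha_k) != 0.
  by rewrite gt_eqF// Gamma_gt0// p0/=; lra.
set s := fun j => Num.sg (x_k j 0 - c_k j 0).
(* The factor common to all three Caputo derivatives below; it is nonzero because [x_j] differs from
   [c_j]. *)
set K := fun j => s j / Gamma (1 - alpha_k) * `|x_k j 0 - c_k j 0| `^ (1 - alpha_k).
have K0 j : K j != 0.
  rewrite /K !mulf_neq0 ?invr_eq0 ?sgr_eq0 ?subr_eq0//.
  by rewrite gt_eqF// powR_gt0// normr_gt0 subr_eq0.
have Did j : caputo (c_k j 0) alpha_k idfun (x_k j 0) = K j / (1 - alpha_k).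
  rewrite (@caputo_affine _ _ _ _ _ 1 0 1 (x_neq_c j) n1).
    by rewrite expr1 !mul0r subr0 mul1r.
  by apply/funext => t; rewrite derive1n1 derive1_id mul0r addr0.
have Dgrad1 j :
    caputo (c_k j 0) alpha_k (coord_fun (quadratic A b c) x_k j) (x_k j 0) =
    K j * ((A *m x_k + b) j 0 / (1 - alpha_k)
           - A j j * (x_k j 0 - c_k j 0) / (2 - alpha_k)).
  rewrite (@caputo_affine _ _ _ _ _ ((A *m x_k + b) j 0) (A j j) 1
    (x_neq_c j) n1); last first.
    by rewrite derive1n1 coord_fun_quadratic// derive1_quadratic_at.
  by rewrite expr1 (_ : 1 - alpha_k + 1 = 2 - alpha_k)//; ring.
(* Both orders leave the same [p = 1 - alpha_k], so [K j] reappears; [n = 2] instead of 1 costs one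
   more sign [s j]. *)
have Dgrad2 j :
    caputo (c_k j 0) (1 + alpha_k) (coord_fun (quadratic A b c) x_k j)
      (x_k j 0) =
    s j * K j * (A j j / (1 - alpha_k)).
  rewrite (@caputo_affine _ _ _ _ _ (A j j) 0 2 (x_neq_c j) n2); last first.
    rewrite derive1nS derive1n1 coord_fun_quadratic// derive1_quadratic_at.
    by rewrite derive1_affine_at; apply/funext => t; rewrite mul0r addr0.
  rewrite (_ : 2 - (1 + alpha_k) = 1 - alpha_k); last by ring.
  by rewrite !mul0r subr0 /K expr2 -!mulrA.
rewrite /caputo_direction.
set D := diag_mx _.
have Du : D \in unitmx.
  rewrite unitmxE det_diag unitfE; apply/prodf_neq0 => j _.
  by rewrite mxE Did mulf_neq0// invr_eq0 gt_eqF.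
(* Multiplying both sides by [D] avoids computing its inverse. *)
apply: (can_inj (mulKmx Du)); rewrite mulKVmx//.
move: (A *m x_k + b) Dgrad1 => G Dgrad1.
apply/colP => j; rewrite /D !mul_diag_mx !mxE Did Dgrad1 Dgrad2 /gamma_coef.
(* The weight [|x_j - c_j|] absorbs the extra sign and becomes [x_j - c_j]. *)
have sL : `|x_k j 0 - c_k j 0| * (s j * K j) = (x_k j 0 - c_k j 0) * K j.
  by rewrite mulrA [_ * s j]mulrC -numEsg.
rewrite [`|_| * _]mulrA sL.
(* After division by [K j / (1 - alpha_k)], the term in [2 - alpha_k] yields the correction
   [(1 - alpha_k) / (2 - alpha_k)] in [gamma_coef]. *)
by field; rewrite !gt_eqF//; lra.
Qed.
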